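(* Let $A\in\mathbb{R}^{m\times n}$ be nonzero, $g(z)=(A^\top z^{\mathsf y},-Az^{\mathsf x})$ and $w_0\in\mathcal{Z}$. In the $\ell_2$-$\ell_2$ setup, consider the estimator $$\tilde g_{w_0}(w)=\left(A^\top w_0^{\mathsf y}+A_{i:}\frac{[w^{\mathsf y}]_i-[w_0^{\mathsf y}]_i}{p_i},\ -Aw_0^{\mathsf x}-A_{:j}\frac{[w^{\mathsf x}]_j-[w_0^{\mathsf x}]_j}{q_j}\right),$$ with $i\sim p$, $j\sim q$ drawn independently, using either the sampling probabilities $$p_i=\frac{\|A_{i:}\|_2^2}{\|A\|_{\mathrm F}^2},\qquad q_j=\frac{\|A_{:j}\|_2^2}{\|A\|_{\mathrm F}^2},$$ or the sampling probabilities $$p_i(w)=\frac{\|A_{i:}\|_2\,|[w^{\mathsf y}]_i-[w_0^{\mathsf y}]_i|}{\sum_{i'\in[m]}\|A_{i':}\|_2\,|[w^{\mathsf y}]_{i'}-[w_0^{\mathsf y}]_{i'}|},\qquad q_j(w)=\frac{\|A_{:j}\|_2\,|[w^{\mathsf x}]_j-[w_0^{\mathsf x}]_j|}{\sum_{j'\in[n]}\|A_{:j'}\|_2\,|[w^{\mathsf x}]_{j'}-[w_0^{\mathsf x}]_{j'}|}.$$ In either case the estimator is $(w_0,L)$-centered for $g$ with $L=\|A\|_{\mathrm F}$.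
   Context: $\ell_2$-$\ell_2$ setup: $\mathcal{X}$ and $\mathcal{Y}$ are the Euclidean unit balls of $\mathbb{R}^n$ and $\mathbb{R}^m$, $\mathcal{Z}=\mathcal{X}\times\mathcal{Y}$, and $\|\cdot\|=\|\cdot\|_*$ is the Euclidean norm; $z^{\mathsf x},z^{\mathsf y}$ are the first $n$ and last $m$ coordinates of $z$. $A_{i:},A_{:j}$ are the $i$th row and $j$th column of $A$ as vectors; $\|A\|_{\mathrm F}=(\sum_{i,j}A_{ij}^2)^{1/2}$. An increment is $0$ if the denominator defining its sampling distribution vanishes. A stochastic estimator $\tilde g_{w_0}:\mathcal{Z}\to\mathcal{Z}^*$ is $(w_0,L)$-centered for $g$ if for all $w\in\mathcal{Z}$: (1) $\mathbb{E}[\tilde g_{w_0}(w)]=g(w)$; (2) $\mathbb{E}\|\tilde g_{w_0}(w)-g(w_0)\|_*^2\le L^2\|w-w_0\|^2$. *)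

(* Defs.v *)
From HB Require Import structures.
From mathcomp Require Import all_boot all_order all_algebra.
From mathcomp Require Import all_classical all_reals all_analysis.
Set Implicit Arguments.
Unset Strict Implicit.
Unset Printing Implicit Defensive.
Import Order.TTheory GRing.Theory Num.Theory.
Local Open Scope classical_set_scope.
Local Open Scope ring_scope.

(* The norm that MathComp-Analysis puts on matrices is the sup norm, hence: *)
Definition l2norm (R : realType) k (v : 'cV[R]_k) : R :=
  Num.sqrt (\sum_i v i 0 ^+ 2).

Definition frobenius (R : realType) m n (A : 'M[R]_(m, n)) : R :=
  Num.sqrt (\sum_i \sum_j A i j ^+ 2).

(* A point z of R^n x R^m is a column vector of height n + m. *)
Definition xpart (R : realType) n m (z : 'cV[R]_(n + m)) : 'cV[R]_n := usubmx z.
Definition ypart (R : realType) n m (z : 'cV[R]_(n + m)) : 'cV[R]_m := dsubmx z.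

Definition unit_ball (R : realType) k : set 'cV[R]_k := [set v | l2norm v <= 1].

Definition Zdom (R : realType) n m : set 'cV[R]_(n + m) :=
  [set z | @unit_ball R n (xpart z) /\ @unit_ball R m (ypart z)].

Definition bilinear_grad (R : realType) m n (A : 'M[R]_(m, n))
    (z : 'cV[R]_(n + m)) : 'cV[R]_(n + m) :=
  col_mx (A^T *m ypart z) (- (A *m xpart z)).

(* In [centered], [gt w] is the random vector produced by the estimator at w.
   The library's 'E_P[_] is defined for every function, so measurability is
   required; a finite value of 'E_P[_] then entails integrability. *)
Definition centered (R : realType) (d : measure_display) (T : measurableType d)
    (P : probability T R) n m (w0 : 'cV[R]_(n + m)) (L : R)
    (g : 'cV[R]_(n + m) -> 'cV[R]_(n + m))
    (gt : 'cV[R]_(n + m) -> T -> 'cV[R]_(n + m)) : Prop :=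
  forall w, @Zdom R n m w ->
  [/\ forall k, measurable_fun [set: T] (fun t => gt w t k 0),
      forall k, ('E_P[fun t => gt w t k 0%R] = (g w k 0%R)%:E)%E
    & ('E_P[fun t => (l2norm (gt w t - g w0) ^+ 2)%R]
         <= (L ^+ 2 * l2norm (w - w0) ^+ 2)%R%:E)%E].

(* A sampling rule on 'I_k draws index i with probability weight i / den.  The
   denominator is kept because a rule with den = 0 defines no distribution. *)
Record sampling (R : realType) (k : nat) := Sampling {
  weight : 'I_k -> R;
  den : R }.

Definition prob (R : realType) k (s : sampling R k) (i : 'I_k) : R :=
  weight s i / den s.

(* 'I_k carries the discrete sigma-algebra.  If den s = 0, the law of I is left
   unspecified (the corresponding increment is then 0, see [increment]). *)
Definition drawn_from (R : realType) (d : measure_display)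
    (T : measurableType d) (P : probability T R) k (I : T -> 'I_k)
    (s : sampling R k) : Prop :=
  (forall B : set 'I_k, measurable (I @^-1` B)) /\
  (den s != 0 -> forall i, P (I @^-1` [set i]) = (prob s i)%:E).

Definition independent (R : realType) (d : measure_display)
    (T : measurableType d) (P : probability T R) k l
    (I : T -> 'I_k) (J : T -> 'I_l) : Prop :=
  forall (B : set 'I_k) (C : set 'I_l),
    (P (I @^-1` B `&` J @^-1` C) = P (I @^-1` B) * P (J @^-1` C))%E.

Definition oblivious_row (R : realType) m n (A : 'M[R]_(m, n)) : sampling R m :=
  Sampling (fun i => l2norm (row i A)^T ^+ 2) (frobenius A ^+ 2).

Definition oblivious_col (R : realType) m n (A : 'M[R]_(m, n)) : sampling R n :=
  Sampling (fun j => l2norm (col j A) ^+ 2) (frobenius A ^+ 2).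

Definition dynamic_row (R : realType) m n (A : 'M[R]_(m, n))
    (w0 w : 'cV[R]_(n + m)) : sampling R m :=
  let a i := l2norm (row i A)^T * `|ypart w i 0 - ypart w0 i 0| in
  Sampling a (\sum_i a i).

Definition dynamic_col (R : realType) m n (A : 'M[R]_(m, n))
    (w0 w : 'cV[R]_(n + m)) : sampling R n :=
  let a j := l2norm (col j A) * `|xpart w j 0 - xpart w0 j 0| in
  Sampling a (\sum_j a j).

(* [increment s v i x] is v * (x / s_i); indices with s_i = 0, where x / s_i
   evaluates to 0, are drawn with probability 0. *)
Definition increment (R : realType) k l (s : sampling R k) (v : 'cV[R]_l)
    (i : 'I_k) (x : R) : 'cV[R]_l :=
  if den s == 0 then 0 else (x / prob s i) *: v.

Definition estimator (R : realType) m n (A : 'M[R]_(m, n))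
    (w0 : 'cV[R]_(n + m)) (p : sampling R m) (q : sampling R n)
    (w : 'cV[R]_(n + m)) (i : 'I_m) (j : 'I_n) : 'cV[R]_(n + m) :=
  col_mx
    (A^T *m ypart w0
       + increment p (row i A)^T i (ypart w i 0 - ypart w0 i 0))
    (- (A *m xpart w0)
       - increment q (col j A) j (xpart w j 0 - xpart w0 j 0)).

(* I w and J w are the random indices drawn when the estimator is queried at w;
   they all live on one probability space, but nothing is assumed about their
   joint law for different w. *)
Definition index_draws (R : realType) (d : measure_display)
    (T : measurableType d) (P : probability T R) n m
    (I : 'cV[R]_(n + m) -> T -> 'I_m) (J : 'cV[R]_(n + m) -> T -> 'I_n)
    (p : 'cV[R]_(n + m) -> sampling R m)
    (q : 'cV[R]_(n + m) -> sampling R n) : Prop :=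
  forall w, @Zdom R n m w ->
  [/\ drawn_from P (I w) (p w), drawn_from P (J w) (q w)
    & independent P (I w) (J w)].

(* Main.v *)
(** Only the marginal laws of the two indices matter: each coordinate of the
    estimator depends on one index, and the squared deviation from [g w0] is the
    sum of the squared norms of the two increments.  For vectors [v i] (rows or
    columns of [A]), scalars [u i] (coordinates of [w - w0]) and probabilities
    [p i], an increment has mean [\sum_i u i *: v i] as soon as [u i *: v i = 0]
    whenever [p i = 0], and second moment [\sum_i u i ^+ 2 * l2norm (v i) ^+ 2 / p i].
    For the oblivious rule each term is at most [frobenius A ^+ 2 * u i ^+ 2];
    for the dynamic rule the sum is [(\sum_i `|u i| * l2norm (v i)) ^+ 2] and
    Cauchy-Schwarz applies. *)
Require Import Defs.
From mathcomp Require Import all_boot all_order all_algebra.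
From mathcomp Require Import all_classical all_reals all_analysis.
From mathcomp Require Import measurable_realfun ring lra.
Import Order.TTheory GRing.Theory Num.Theory.
Local Open Scope classical_set_scope.
Local Open Scope ring_scope.

(** * Cauchy-Schwarz and identities for Euclidean norms *)

Lemma sum_mul_sqr_le (R : realType) k (a b : 'I_k -> R) :
  (\sum_i a i * b i) ^+ 2 <= (\sum_i a i ^+ 2) * (\sum_i b i ^+ 2).
Proof.
(* Lagrange's identity: the doubled gap is the sum over [i], [j] of the squares
   [(a i * b j - a j * b i) ^+ 2]. *)
have h : (\sum_i a i * b i) ^+ 2 *+ 2 <=
    (\sum_i a i ^+ 2) * (\sum_i b i ^+ 2) *+ 2.
  rewrite expr2 [X in _ <= X]mulr2n [X in _ <= _ + X]mulrC.
  rewrite !big_distrlr -sumrMnl -big_split /=; apply: ler_sum => i _.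
  rewrite -sumrMnl -big_split /=; apply: ler_sum => j _.
  by rewrite -subr_ge0; have := sqr_ge0 (a i * b j - a j * b i); lra.
by rewrite ler_pMn2r in h.
Qed.

Lemma l2norm_ge0 {R : realType} {k} (v : 'cV[R]_k) : 0 <= l2norm v.
Proof. exact: sqrtr_ge0. Qed.

Lemma l2norm_sqr {R : realType} {k} (v : 'cV[R]_k) :
  l2norm v ^+ 2 = \sum_i v i 0 ^+ 2.
Proof. by rewrite sqr_sqrtr// sumr_ge0// => i _; rewrite sqr_ge0. Qed.

Lemma l2norm_eq0 {R : realType} {k} (v : 'cV[R]_k) : l2norm v = 0 -> v = 0.
Proof.
move=> v0; have := l2norm_sqr v; rewrite v0 expr0n /= => /esym/eqP.
rewrite psumr_eq0 => [/allP h|i _]; last exact: sqr_ge0.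
apply/matrixP => i j; rewrite ord1 mxE.
by have := h i (mem_index_enum _); rewrite implyTb sqrf_eq0 => /eqP.
Qed.

Lemma l2normZ_sqr {R : realType} {k} (a : R) (v : 'cV[R]_k) :
  l2norm (a *: v) ^+ 2 = a ^+ 2 * l2norm v ^+ 2.
Proof.
by rewrite !l2norm_sqr big_distrr; apply: eq_bigr => i _; rewrite mxE exprMn.
Qed.

Lemma l2norm_col_mx_sqr {R : realType} {k l} (v : 'cV[R]_k) (w : 'cV[R]_l) :
  l2norm (col_mx v w) ^+ 2 = l2norm v ^+ 2 + l2norm w ^+ 2.
Proof.
rewrite !l2norm_sqr big_split_ord; congr (_ + _).
  by apply: eq_bigr => i _; rewrite col_mxEu.
by apply: eq_bigr => i _; rewrite col_mxEd.
Qed.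

Lemma frobenius_sqr_row {R : realType} {m n} (A : 'M[R]_(m, n)) :
  frobenius A ^+ 2 = \sum_i l2norm (row i A)^T ^+ 2.
Proof.
rewrite sqr_sqrtr; last by do 2![rewrite sumr_ge0// => ? _]; rewrite sqr_ge0.
apply: eq_bigr => i _; rewrite l2norm_sqr.
by apply: eq_bigr => j _; rewrite !mxE.
Qed.

Lemma frobenius_sqr_col {R : realType} {m n} (A : 'M[R]_(m, n)) :
  frobenius A ^+ 2 = \sum_j l2norm (col j A) ^+ 2.
Proof.
rewrite sqr_sqrtr; last by do 2![rewrite sumr_ge0// => ? _]; rewrite sqr_ge0.
rewrite exchange_big; apply: eq_bigr => j _; rewrite l2norm_sqr.
by apply: eq_bigr => i _; rewrite !mxE.
Qed.

(** * Expectations of functions of a random index *)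

Section FiniteRandomVariable.
Context {R : realType} {d : measure_display} {T : measurableType d}.
Context (P : probability T R) {k : nat} {I : T -> 'I_k}.
Hypothesis mI : forall B : set 'I_k, measurable (I @^-1` B).

Lemma measurable_comp_ord (f : 'I_k -> R) :
  measurable_fun [set: T] (fun t => f (I t)).
Proof. by move=> _ B _; rewrite setTI; exact: (mI (f @^-1` B)). Qed.

(** Such a function is a finite combination of indicators of the fibres of [I], so linearity of the
    integral applies. *)
Lemma expectation_comp_ord (f : 'I_k -> R) :
  ('E_P[fun t => f (I t)] = \sum_i (f i)%:E * P (I @^-1` [set i]))%E.
Proof.
rewrite unlock.
under eq_integral => t _.
  have -> : (f (I t))%:E =
      (\sum_i (f i)%:E * (\1_(I @^-1` [set i]) t)%:E)%E.
    rewrite (bigD1 (I t)) //= big1 => [|i iI].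
      by rewrite indicE mem_set //= mule1 adde0.
    rewrite indicE memNset ?mule0 //= => Iti.
    by rewrite Iti eqxx in iI.
  over.
have intI i : P.-integrable setT (fun t => (\1_(I @^-1` [set i]) t)%:E).
  exact: integrable_indic.
rewrite integral_sum// => [|i]; last exact: integrableZl.
by apply: eq_bigr => i _; rewrite integralZl// integral_indic// setIT.
Qed.

End FiniteRandomVariable.

(* If [den s = 0] then [prob s i] and [x / prob s i] are 0 (division by zero). *)
Lemma incrementE {R : realType} {k l} (s : sampling R k) (v : 'cV[R]_l) i x :
  increment s v i x = (x / prob s i) *: v.
Proof.
rewrite /increment /prob; case: eqP => // ->.
by rewrite !invr0 !mulr0 invr0 mulr0 scale0r.
Qed.

(** * First and second moments of an increment *)

Section Increment.
Context {R : realType} {d : measure_display} {T : measurableType d}.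
Context (P : probability T R) {k l : nat} {I : T -> 'I_k} {s : sampling R k}.
Context {v : 'I_k -> 'cV[R]_l} {u : 'I_k -> R}.
Hypothesis Is : drawn_from P I s.

Let p i := fine (P (I @^-1` [set i])).

Let pE i : P (I @^-1` [set i]) = (p i)%:E.
Proof. by rewrite fineK// fin_num_measure//; exact: (Is.1). Qed.

Let sum_p : \sum_i p i = 1.
Proof.
have := @expectation_comp_ord _ _ _ P _ _ (Is.1) (fun=> 1).
rewrite expectation_cst; under eq_bigr do rewrite pE mul1e.
by rewrite sumEFin => -[].
Qed.

(** The true law [p] agrees with [prob s] when [den s] is nonzero; otherwise [prob s i] is 0 and
    both sides vanish. The moment computations thus avoid a case split on [den s]. *)
Let p_prob i : p i * (prob s i)^-1 = prob s i / prob s i.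
Proof.
have [s0|s0] := eqVneq (den s) 0.
  by rewrite /prob s0 invr0 mulr0 invr0 !mulr0.
by rewrite /p (Is.2 s0).
Qed.

(** The weight [(prob s i)^-1] cancels the probability of drawing [i]. The constant [c] and the sign
    [e] let one statement serve both blocks of the estimator. *)
Lemma increment_mean (c e : R) j :
    (forall i, prob s i = 0 -> u i *: v i = 0) ->
  ('E_P[fun t => (c + e * increment s (v (I t)) (I t) (u (I t)) j 0)%R] =
   (c + e * \sum_i u i * v i j 0)%:E)%E.
Proof.
move=> supp.
rewrite (expectation_comp_ord P (Is.1)
  (fun i => c + e * increment s (v i) i (u i) j 0)).
under eq_bigr do rewrite pE -EFinM.
rewrite sumEFin; congr _%:E.
under eq_bigr do rewrite mulrDl.
rewrite big_split /= -mulr_sumr sum_p mulr1 mulr_sumr; congr (_ + _).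
apply: eq_bigr => i _; rewrite incrementE mxE -[LHS]mulrA; congr (_ * _).
have -> : u i / prob s i * v i j 0 * p i =
  (p i * (prob s i)^-1) * (u i * v i j 0) by ring.
rewrite p_prob; have [p0|p0] := eqVneq (prob s i) 0.
  by have /matrixP/(_ j 0) := supp _ p0; rewrite !mxE => ->; rewrite mulr0.
by rewrite divff// mul1r.
Qed.

Lemma increment_second_moment :
  ('E_P[fun t => (l2norm (increment s (v (I t)) (I t) (u (I t))) ^+ 2)%R] =
   (\sum_i u i ^+ 2 * l2norm (v i) ^+ 2 / prob s i)%:E)%E.
Proof.
rewrite (expectation_comp_ord P (Is.1)
  (fun i => l2norm (increment s (v i) i (u i)) ^+ 2)).
under eq_bigr do rewrite pE -EFinM.
rewrite sumEFin; congr _%:E; apply: eq_bigr => i _.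
rewrite incrementE l2normZ_sqr.
have -> : (u i / prob s i) ^+ 2 * l2norm (v i) ^+ 2 * p i =
  u i ^+ 2 * l2norm (v i) ^+ 2 * (prob s i)^-1 * (p i * (prob s i)^-1) by ring.
(* One of the two factors [(prob s i)^-1] cancels against [p i]; if [prob s i] is 0, both sides are
   0. *)
rewrite p_prob; have [->|p0] := eqVneq (prob s i) 0.
  by rewrite invr0 !mulr0.
by rewrite divff// mulr1.
Qed.

End Increment.

(** What centering requires of a sampling rule: the first clause makes the increment unbiased, the
    second bounds its second moment by [F] times the squared norm of [u]. *)
Definition admissible {R : realType} {k l} (s : sampling R k)
    (v : 'I_k -> 'cV[R]_l) (u : 'I_k -> R) (F : R) :=
  (forall i, prob s i = 0 -> u i *: v i = 0) /\
  \sum_i u i ^+ 2 * l2norm (v i) ^+ 2 / prob s i <= F * \sum_i u i ^+ 2.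

Lemma oblivious_admissible {R : realType} {k l} (v : 'I_k -> 'cV[R]_l)
    (u : 'I_k -> R) (F : R) :
  F = \sum_i l2norm (v i) ^+ 2 ->
  admissible (Sampling (fun i => l2norm (v i) ^+ 2) F) v u F.
Proof.
move=> FE.
have F0 : 0 <= F by rewrite FE sumr_ge0// => i _; exact: sqr_ge0.
have v_le i : l2norm (v i) ^+ 2 <= F.
  by rewrite FE (bigD1 i)//= lerDl sumr_ge0// => j _; exact: sqr_ge0.
split => [i|].
  rewrite /prob /= => /eqP; rewrite mulf_eq0 invr_eq0 => h.
  have : l2norm (v i) ^+ 2 = 0.
    (* If the denominator [F] vanishes, [v_le] forces every [v i] to have norm 0. *)
    case/orP: h => /eqP // F_eq0; apply: le_anti.
    by rewrite sqr_ge0 andbT -F_eq0.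
  by move/eqP; rewrite sqrf_eq0 => /eqP /l2norm_eq0 ->; rewrite scaler0.
rewrite mulr_sumr; apply: ler_sum => i _; rewrite /prob /=.
(* A term with [v i] of norm 0 is 0; any other term equals [F * u i ^+ 2]. *)
have [->|v0] := eqVneq (l2norm (v i) ^+ 2) 0.
  by rewrite mulr0 mul0r mulr_ge0// sqr_ge0.
by rewrite invf_div -mulrA [X in _ * X]mulrCA divff// mulr1 mulrC.
Qed.

Lemma dynamic_admissible {R : realType} {k l} (v : 'I_k -> 'cV[R]_l)
    (u : 'I_k -> R) :
  let a i := l2norm (v i) * `|u i| in
  admissible (Sampling a (\sum_i a i)) v u (\sum_i l2norm (v i) ^+ 2).
Proof.
move=> a.
have a0 i : 0 <= a i by rewrite mulr_ge0// l2norm_ge0.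
split => [i|].
  rewrite /prob /= => /eqP; rewrite mulf_eq0 invr_eq0 => h.
  (* A vanishing denominator is a zero sum of nonnegative terms, so [a i] is 0 in either case. *)
  have : a i == 0.
    case/orP: h => //; rewrite psumr_eq0// => /allP /(_ i).
    by rewrite mem_index_enum implyTb => ->.
  rewrite mulf_eq0 normr_eq0 => /orP[/eqP/l2norm_eq0 ->|/eqP ->].
    by rewrite scaler0.
  by rewrite scale0r.
(* With [S] the sum of the [a i], each term is [a i ^+ 2 / (a i / S)], that is [a i * S], also when
   [a i] is 0. *)
have -> : \sum_i u i ^+ 2 * l2norm (v i) ^+ 2 /
    prob (Sampling a (\sum_i a i)) i = (\sum_i a i) ^+ 2.
  rewrite expr2 mulr_suml; apply: eq_bigr => i _.
  rewrite /prob /= -exprMn [u i * _]mulrC -real_normK ?num_real//.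
  rewrite normrM (ger0_norm (l2norm_ge0 _)) -/(a i) invf_div.
  have [->|ai0] := eqVneq (a i) 0; first by rewrite expr0n !mul0r.
  by field.
apply: le_trans (sum_mul_sqr_le _ _ _ _) _.
by under [X in _ * X <= _]eq_bigr do rewrite real_normK ?num_real//.
Qed.

(** * Centering of the estimator *)

Lemma estimator_centered (R : realType) (d : measure_display)
    (T : measurableType d) (P : probability T R) (m n : nat)
    (A : 'M[R]_(m, n)) (w0 : 'cV[R]_(n + m))
    (I : 'cV[R]_(n + m) -> T -> 'I_m) (J : 'cV[R]_(n + m) -> T -> 'I_n)
    (p : 'cV[R]_(n + m) -> sampling R m) (q : 'cV[R]_(n + m) -> sampling R n) :
    (forall w, admissible (p w) (fun i => (row i A)^T)
       (fun i => ypart w i 0 - ypart w0 i 0) (frobenius A ^+ 2)) ->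
    (forall w, admissible (q w) (fun j => col j A)
       (fun j => xpart w j 0 - xpart w0 j 0) (frobenius A ^+ 2)) ->
    index_draws P I J p q ->
  centered P w0 (frobenius A) (bilinear_grad A)
    (fun w t => estimator A w0 (p w) (q w) w (I w t) (J w t)).
Proof.
move=> padm qadm draws w Zw.
have [supp_p mom_p] := padm w; have [supp_q mom_q] := qadm w.
have [Ip Jq _] := draws w Zw.
pose incI i := increment (p w) (row i A)^T i (ypart w i 0 - ypart w0 i 0).
pose incJ j := increment (q w) (col j A) j (xpart w j 0 - xpart w0 j 0).
have lshiftE k t :
    estimator A w0 (p w) (q w) w (I w t) (J w t) (lshift m k) 0 =
    (A^T *m ypart w0) k 0 + 1 * incI (I w t) k 0.
  by rewrite col_mxEu mxE mul1r.
have rshiftE k t :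
    estimator A w0 (p w) (q w) w (I w t) (J w t) (rshift n k) 0 =
    - (A *m xpart w0) k 0 + -1 * incJ (J w t) k 0.
  by rewrite col_mxEd mxE mulN1r; congr (_ + _); rewrite mxE.
split.
- move=> k; have [k' ->|k' ->] := split_ordP k.
    apply: (eq_measurable_fun (fun t =>
      (A^T *m ypart w0) k' 0 + 1 * incI (I w t) k' 0)) => [t _|].
      by rewrite lshiftE.
    exact: (measurable_comp_ord Ip.1
      (fun i => (A^T *m ypart w0) k' 0 + 1 * incI i k' 0)).
  apply: (eq_measurable_fun (fun t =>
    - (A *m xpart w0) k' 0 + -1 * incJ (J w t) k' 0)) => [t _|].
    by rewrite rshiftE.
  exact: (measurable_comp_ord Jq.1
    (fun j => - (A *m xpart w0) k' 0 + -1 * incJ j k' 0)).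
- move=> k; have [k' ->|k' ->] := split_ordP k.
    under eq_fun do rewrite lshiftE.
    (* By linearity, the mean increment [A^T *m (ypart w - ypart w0)] completes the fixed part to
       [A^T *m ypart w]. *)
    rewrite (increment_mean P Ip _ _ _ supp_p) col_mxEu; congr _%:E.
    rewrite mul1r !mxE -big_split; apply: eq_bigr => i _.
    by rewrite /= !mxE; ring.
  under eq_fun do rewrite rshiftE.
  rewrite (increment_mean P Jq _ _ _ supp_q) col_mxEd; congr _%:E.
  rewrite mulN1r !mxE -opprD -big_split; congr (- _); apply: eq_bigr => i _.
  by rewrite /= !mxE; ring.
(* The fixed parts are exactly [bilinear_grad A w0], so only the two increments survive, in separate
   blocks. *)
- have devE t : l2norm (estimator A w0 (p w) (q w) w (I w t) (J w t) -
      bilinear_grad A w0) ^+ 2 =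
      l2norm (incI (I w t)) ^+ 2 + l2norm (incJ (J w t)) ^+ 2.
    rewrite opp_col_mx add_col_mx l2norm_col_mx_sqr; congr (_ + _).
      by rewrite addrAC subrr add0r.
    by rewrite opprK addrAC addNr add0r -scaleN1r l2normZ_sqr sqrrN expr1n mul1r.
  under eq_fun do rewrite devE.
  rewrite unlock; under eq_integral do rewrite EFinD.
  have mI := measurable_comp_ord Ip.1 (fun i => l2norm (incI i) ^+ 2).
  have mJ := measurable_comp_ord Jq.1 (fun j => l2norm (incJ j) ^+ 2).
  rewrite ge0_integralD//=; first last.
  - exact/measurable_EFinP.
  - by move=> t _; rewrite lee_fin sqr_ge0.
  - exact/measurable_EFinP.
  - by move=> t _; rewrite lee_fin sqr_ge0.
  have := increment_second_moment P Ip (v := fun i => (row i A)^T)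
    (u := fun i => ypart w i 0 - ypart w0 i 0).
  rewrite unlock => ->.
  have := increment_second_moment P Jq (v := fun j => col j A)
    (u := fun j => xpart w j 0 - xpart w0 j 0).
  rewrite unlock => ->.
  rewrite -EFinD lee_fin; apply: le_trans (lerD mom_p mom_q) _.
  (* The two coordinate sums add up to [l2norm (w - w0) ^+ 2]; they are swapped because row
     increments carry the lower block [ypart]. *)
  rewrite -mulrDr ler_wpM2l ?sqr_ge0// l2norm_sqr big_split_ord /= addrC.
  by rewrite le_eqVlt; apply/orP; left; apply/eqP; congr (_ + _);
    apply: eq_bigr => i _; rewrite !mxE.
Qed.

Theorem lemma10 (R : realType) (m n : nat) (A : 'M[R]_(m, n))
    (w0 : 'cV[R]_(n + m)) (d : measure_display) (T : measurableType d)
    (P : probability T R)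
    (I : 'cV[R]_(n + m) -> T -> 'I_m) (J : 'cV[R]_(n + m) -> T -> 'I_n)
    (hA : A != 0) (hw0 : @Zdom R n m w0) :
  (index_draws P I J (fun=> oblivious_row A) (fun=> oblivious_col A) ->
   centered P w0 (frobenius A) (bilinear_grad A)
     (fun w t => estimator A w0 (oblivious_row A) (oblivious_col A)
                   w (I w t) (J w t)))
  /\
  (index_draws P I J (dynamic_row A w0) (dynamic_col A w0) ->
   centered P w0 (frobenius A) (bilinear_grad A)
     (fun w t => estimator A w0 (dynamic_row A w0 w) (dynamic_col A w0 w)
                   w (I w t) (J w t))).
Proof.
(* The common constant [frobenius A ^+ 2] is read as the sum of squared row norms for [I] and of
   squared column norms for [J]. *)
split; apply: estimator_centered => w.
- exact/oblivious_admissible/frobenius_sqr_row.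
- exact/oblivious_admissible/frobenius_sqr_col.
- by rewrite frobenius_sqr_row; exact: dynamic_admissible.
- by rewrite frobenius_sqr_col; exact: dynamic_admissible.
Qed.
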